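(* Fix $\rho\in(0,1)$. For each $n\ge 2$ let $X=(X_1,\dots,X_n)'$ be jointly normal with $E[X_i]=0$, $E[X_i^2]=1$ and $\operatorname{Corr}(X_i,X_j)=\rho$ for all $i\neq j$. Let $s_n^2$ be the sample variance of $X$ and $\widehat\rho=(1-s_n^2)\,I(s_n^2<1)$. Then for every sequence of positive reals $(a_n)$ with $a_n=o(n)$, $$\sqrt{a_n}\left(\sqrt{1-\rho}-\sqrt{1-\widehat\rho}\right)\xrightarrow[n\to\infty]{P}0.$$ In particular (taking $a_n=2\ln n$), $\widehat\rho$ satisfies $\sqrt{2\ln n}\,\big(\sqrt{1-\rho}-\sqrt{1-\widehat\rho}\big)\xrightarrow{P}0$.
   Context: The sample variance is $s_n^2=\frac{1}{n-1}X'\left(I_n-\frac1n J_n\right)X$, where $I_n$ is the $n\times n$ identity matrix and $J_n$ the $n\times n$ matrix of ones. $I(\cdot)$ denotes the indicator function. The correlation $\rho$ does not depend on $n$. *)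

(* Defs.v *)
From HB Require Import structures.
From mathcomp Require Import all_boot all_order all_algebra.
From mathcomp Require Import all_classical all_reals all_analysis.
Set Implicit Arguments. Unset Strict Implicit. Unset Printing Implicit Defensive.
Import Order.TTheory GRing.Theory Num.Theory.
Import numFieldNormedType.Exports.
Local Open Scope classical_set_scope.
Local Open Scope ring_scope.

Definition lincomb {T : Type} {R : realType} (n : nat)
  (X : 'I_n -> T -> R) (t : 'I_n -> R) : T -> R :=
  fun w => \sum_(i < n) t i * X i w.

Definition quadform {R : realType} (n : nat) (S : 'M[R]_n) (t : 'I_n -> R) : R :=
  \sum_(i < n) \sum_(j < n) t i * S i j * t j.

(* X = (X_1,...,X_n) is jointly normal with mean 0 and covariance matrix S:
   every linear combination t'X is N(0, t'S t) (a point mass at 0 when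
   t'S t = 0).  (Cramer-Wold definition of a Gaussian vector.) *)
Definition centered_gaussian_vector {d : measure_display} {T : measurableType d}
  {R : realType} (P : probability T R) (n : nat)
  (X : 'I_n -> {RV P >-> R}) (S : 'M[R]_n) : Prop :=
  forall t : 'I_n -> R,
    if 0 < quadform S t then
      forall B : set R, measurable B ->
        P (lincomb (fun i => (X i : T -> R)) t @^-1` B)
        = normal_prob 0 (Num.sqrt (quadform S t)) B
    else P [set w | lincomb (fun i => (X i : T -> R)) t w != 0] = 0%E.

Definition equicorr {R : realType} (n : nat) (rho : R) : 'M[R]_n :=
  \matrix_(i < n, j < n) (if i == j then 1 else rho).

Definition sample_var {R : realType} (n : nat) (x : 'cV[R]_n) : R :=
  (n.-1%:R)^-1 *
  (x^T *m (1%:M - (n%:R)^-1 *: const_mx 1) *m x) ord0 ord0.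

Definition rho_hat {R : realType} (s2 : R) : R := if s2 < 1 then 1 - s2 else 0.

(* Main.v *)
(** The deviations [X_i - mean X] are linear combinations of [X] whose
coefficients sum to zero, hence centered normal with covariances
[(1 - rho) (delta_ij - 1/n)]. Second and fourth normal moments, polarized, give
[E (s2 - (1 - rho))^2 = 2 (1 - rho)^2 / (n - 1)]. Since
[|sqrt (1 - rho) - sqrt (min s2 1)| <= |s2 - (1 - rho)| / sqrt (1 - rho)],
Chebyshev bounds the probability by a constant times [a_n / n]. *)

Require Import Defs.
From HB Require Import structures.
From mathcomp Require Import all_boot all_order all_algebra.
From mathcomp Require Import all_classical all_reals all_analysis.
From mathcomp Require Import measurable_realfun ring lra.
Import Order.TTheory GRing.Theory Num.Theory.
Import numFieldNormedType.Exports.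
Local Open Scope classical_set_scope.
Local Open Scope ring_scope.

Set Implicit Arguments.
Unset Strict Implicit.
Unset Printing Implicit Defensive.

(** * Second and fourth moments of the centered normal density *)

Section normal_moments.
Context {R : realType}.
Variable s : R.
Hypothesis s0 : 0 < s.
Local Notation mu := (@lebesgue_measure R).
Let p := normal_pdf 0 s.

Let pE x : p x = normal_peak s * expR (- (x ^+ 2 / (s ^+ 2 *+ 2))).
Proof.
by rewrite /p normal_pdfE ?gt_eqF// /normal_fun subr0 mulNr.
Qed.

Let p_ge0 x : 0 <= p x. Proof. exact: normal_pdf_ge0. Qed.

Let cp : continuous p.
Proof. by apply: continuous_normal_pdf; rewrite gt_eqF. Qed.

(** This differential equation makes [- s ^+ 2 * p x] an antiderivative of [x * p x], the pair on
    which the integration by parts rests. *)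
Let dp (x : R) : is_derive x 1 p (- (x / s ^+ 2) * p x).
Proof.
have -> : p = fun x => normal_peak s * expR (- (x ^+ 2 / (s ^+ 2 *+ 2))).
  by apply/funext => y; exact: pE.
apply: is_derive_eq.
rewrite /GRing.scale/=; field.
by rewrite gt_eqF.
Qed.

Lemma normal_pdf_expr_le k x : 0 < x ->
  x ^+ k.+1 * p x <= normal_peak s * (k.+1`!%:R * (s ^+ 2 *+ 2) ^+ k.+1) / x ^+ k.+1.
Proof.
move=> x0; rewrite pE.
set v := s ^+ 2 *+ 2.
have v0 : 0 < v by rewrite /v pmulrn_lgt0// exprn_gt0.
have y0 : 0 <= x ^+ 2 / v by rewrite divr_ge0 ?sqr_ge0 ?ltW.
have f0 : 0 < (k.+1`!)%:R :> R by rewrite ltr0n fact_gt0.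
have := expR_ge1Dxn k y0.
set e := expR _; have e0 : 0 < e by exact: expR_gt0.
move=> h.
have {}h : x ^+ k.+1 * x ^+ k.+1 <= e * ((k.+1)`!%:R * v ^+ k.+1).
  have h1 : (x ^+ 2 / v) ^+ k.+1 / (k.+1)`!%:R <= e.
    by apply: le_trans h; rewrite lerDr ler01.
  rewrite ler_pdivrMr// exprMn exprVn ler_pdivrMr ?exprn_gt0// in h1.
  by rewrite -exprMn -expr2 mulrA.
rewrite expRN -/e ler_pdivlMr ?exprn_gt0//.
rewrite [leLHS](_ : _ = normal_peak s * (x ^+ k.+1 * x ^+ k.+1 / e)); last by ring.
rewrite ler_wpM2l ?normal_peak_ge0//.
by rewrite ler_pdivrMr// [leRHS]mulrC.
Qed.

Lemma cvg_normal_pdf_expr k : (n%:R ^+ k.+1 * p n%:R : R) @[n --> \oo] --> (0 : R).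
Proof.
pose C := normal_peak s * (k.+1`!%:R * (s ^+ 2 *+ 2) ^+ k.+1).
have C0 : 0 <= C.
  by rewrite !mulr_ge0 ?normal_peak_ge0// exprn_ge0// mulrn_wge0// sqr_ge0.
apply: (@squeeze_cvgr _ _ _ _ (cst 0) (fun n : nat => C * n%:R^-1)).
- near=> n; have n0 : (0 < n)%N by near: n; exact: nbhs_infty_gt.
  have n1 : 1 <= n%:R :> R by rewrite ler1n.
  rewrite /= mulr_ge0 ?exprn_ge0 ?ler0n//=.
  apply: (le_trans (@normal_pdf_expr_le k n%:R _)); first by rewrite ltr0n.
  (* For [n >= 1] the power [n ^ (k+1)] is at least [n], so a bound [C / n] serves every [k]. *)
  rewrite ler_wpM2l// lef_pV2 ?posrE ?exprn_gt0 ?ltr0n//.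
  by rewrite exprS ler_peMr ?ler0n// exprn_ege1.
- exact: cvg_cst.
- rewrite -[X in _ --> X](mulr0 C); apply: cvgM; first exact: cvg_cst.
  apply/gtr0_cvgV0; last exact: cvgr_idn.
  by near=> n; rewrite ltr0n; near: n; exact: nbhs_infty_gt.
Unshelve. all: end_near. Qed.

Let mXp k : measurable_fun [set: R] (fun x : R => x ^+ k * p x).
Proof.
apply: measurable_funM => //.
exact: measurable_normal_pdf.
Qed.

Let cXp k : continuous (fun x : R => x ^+ k * p x).
Proof. by move=> x; apply: cvgM; [exact: exprn_continuous|exact: cp]. Qed.

Let by_parts k (b : R) : 0 < b ->
  (\int[mu]_(x in `[0%R, b]) (x ^+ k.+2 * p x)%:E =
   (- (s ^+ 2 * (b ^+ k.+1 * p b)))%:E +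
   (k.+1%:R * s ^+ 2)%:E * \int[mu]_(x in `[0%R, b]) (x ^+ k * p x)%:E)%E.
Proof.
move=> b0.
transitivity (\int[mu]_(x in `[0%R, b]) (x ^+ k.+1 * (x * p x))%:E)%E.
  by apply: eq_integral => x _; rewrite exprSr mulrA.
rewrite (@integration_by_parts R (fun x => x ^+ k.+1) (fun x => - s ^+ 2 * p x)
  (fun x => k.+1%:R * x ^+ k) (fun x => x * p x))//.
- rewrite expr0n/= mul0r subr0; congr (_ + _)%E.
    by congr _%:E; ring.
  transitivity (- \int[mu]_(x in `[0%R, b])
      ((- (k.+1%:R * s ^+ 2))%:E * (x ^+ k * p x)%:E))%E.
    by congr (- _)%E; apply: eq_integral => x _; rewrite -EFinM; congr _%:E; ring.
  rewrite integralZl//; first by rewrite EFinN mulNe oppeK.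
  apply: continuous_compact_integrable; first exact: segment_compact.
  exact: continuous_subspaceT.
- apply: continuous_subspaceT => x; apply: cvgM; first exact: cvg_cst.
  exact: exprn_continuous.
- split.
  + by move=> x _; exact: exprn_derivable.
  + by apply: cvg_at_right_filter; exact: exprn_continuous.
  + by apply: cvg_at_left_filter; exact: exprn_continuous.
- by move=> x _; rewrite derive1E exp_derive scaler1.
- by apply: continuous_subspaceT; move: (@cXp 1).
- split.
  + by move=> x _; have dpx := dp x; exact: ex_derive.
  + by apply: cvg_at_right_filter; apply: cvgM; [exact: cvg_cst|exact: cp].
  + by apply: cvg_at_left_filter; apply: cvgM; [exact: cvg_cst|exact: cp].
- move=> x _; have dpx := dp x; rewrite derive1E derive_val /GRing.scale/=; field.
  by rewrite gt_eqF.
Qed.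

(** Let [b = n] tend to infinity in [by_parts]: the boundary term tends to 0, and both integrals
    converge to those over the half-line. Evenness of [k] keeps the integrands nonnegative on the
    whole line. *)
Let moment0y_rec k (M : R) : ~~ odd k ->
  (\int[mu]_(x in `[0%R, +oo[) (x ^+ k * p x)%:E = M%:E)%E ->
  (\int[mu]_(x in `[0%R, +oo[) (x ^+ k.+2 * p x)%:E =
   (k.+1%:R * s ^+ 2 * M)%:E)%E.
Proof.
move=> ek kM.
have Xp_ge0 j x : ~~ odd j -> 0 <= x ^+ j * p x.
  by move=> ej; rewrite mulr_ge0// exprn_even_ge0.
have cvgk : (\int[mu]_(x in `[0%R, n%:R]) (x ^+ k * p x)%:E @[n --> \oo]
    --> M%:E)%E.
  by rewrite -kM; apply: ge0_cvgn_integral => // x; exact: Xp_ge0.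
have cvgk2 := @ge0_cvgn_integral R mu (fun x => x ^+ k.+2 * p x).
have {}cvgk2 := cvgk2 (fun x => Xp_ge0 k.+2 x (etrans (congr1 negb (negbK _)) ek))
  (mXp k.+2).
rewrite -(cvg_lim _ cvgk2)//; apply/cvg_lim => //.
(* The limit is rewritten with [- (s ^+ 2 * 0)] in front, to match the limit of the boundary
   term. *)
rewrite -[X in _ --> X]add0e [X in (X + _)%E](_ : _ = (- (s ^+ 2 * 0))%:E); last first.
  by rewrite mulr0 oppr0.
rewrite EFinM.
suff : ((- (s ^+ 2 * (n%:R ^+ k.+1 * p n%:R)))%:E +
   (k.+1%:R * s ^+ 2)%:E * \int[mu]_(x in `[0%R, n%:R]) (x ^+ k * p x)%:E)%E
   @[n --> \oo] --> ((- (s ^+ 2 * 0))%:E + (k.+1%:R * s ^+ 2)%:E * M%:E)%E.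
  apply: cvg_trans; apply: near_eq_cvg; near=> n.
  rewrite -by_parts// ltr0n; near: n; exact: nbhs_infty_gt.
apply: cvgeD => //.
  apply: cvg_EFin; first by near=> n.
  apply: cvgN; apply: cvgM; first exact: cvg_cst.
  exact: cvg_normal_pdf_expr.
exact: cvgeZl.
Unshelve. all: end_near. Qed.

Let momentT k : ~~ odd k ->
  (\int[mu]_x (x ^+ k * p x)%:E =
   2%:E * \int[mu]_(x in `[0%R, +oo[) (x ^+ k * p x)%:E)%E.
Proof.
move=> ek; rewrite ge0_symfun_integralT.
- by rewrite set_itvcy.
- by move=> x; rewrite mulr_ge0// exprn_even_ge0.
- exact: cXp.
- by move=> x /=; rewrite exprNn -signr_odd (negbTE ek) mul1r !pE sqrrN.
Qed.

Let moment0 : (\int[mu]_(x in `[0%R, +oo[) (x ^+ 0 * p x)%:E = (2^-1)%:E)%E.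
Proof.
have := @momentT 0 isT.
under eq_integral do rewrite expr0 mul1r.
rewrite integral_normal_pdf.
(* By symmetry twice this extended real is the total mass 1, which excludes the infinite values. *)
case: (\int[mu]_(x in _) _)%E => [r||]/=.
- by rewrite -EFinM => -[] r1; congr _%:E; lra.
- by rewrite gt0_muley// lte_fin.
- by rewrite gt0_muleNy// lte_fin.
Qed.

Lemma normal_pdf_moment2 : (\int[mu]_x (x ^+ 2 * p x)%:E = (s ^+ 2)%:E)%E.
Proof.
by rewrite momentT// (@moment0y_rec 0 _ isT moment0) -EFinM; congr _%:E; field.
Qed.

Lemma normal_pdf_moment4 : (\int[mu]_x (x ^+ 4 * p x)%:E = (3 * s ^+ 4)%:E)%E.
Proof.
rewrite momentT// (@moment0y_rec 2 _ isT (@moment0y_rec 0 _ isT moment0)) -EFinM.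
by congr _%:E; field.
Qed.

End normal_moments.

(** The Radon-Nikodym derivative of the normal law and its explicit density have the same integral
    over every measurable set, hence agree almost everywhere. *)
Lemma ge0_integral_normal_prob (R : realType) (m s : R) (f : R -> \bar R) :
  (forall x, 0 <= f x)%E -> measurable_fun [set: R] f ->
  (\int[normal_prob m s]_x f x =
   \int[lebesgue_measure]_x (f x * (normal_pdf m s x)%:E))%E.
Proof.
move=> f0 mf.
have dom := normal_prob_dominates m s.
rewrite -(Radon_Nikodym_SigmaFinite.change_of_variables dom)//.
have RNi := Radon_Nikodym_SigmaFinite.f_integrable dom.
have mRN := measurable_int _ RNi.
have mpdf : measurable_fun [set: R] (fun x => (normal_pdf m s x)%:E).
  by apply/measurable_EFinP; exact: measurable_normal_pdf.
apply: ge0_ae_eq_integral => //.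
- exact: emeasurable_funM.
- exact: emeasurable_funM.
- by move=> x _; rewrite mule_ge0// Radon_Nikodym_SigmaFinite.f_ge0.
- by move=> x _; rewrite mule_ge0// lee_fin normal_pdf_ge0.
- apply: ae_eqe_mul2l; apply: integral_ae_eq => // E _ mE.
  by rewrite -Radon_Nikodym_SigmaFinite.f_integral.
Qed.

(** * Expectations of nonnegative random variables *)

Section ge0_mean.
Context {d : measure_display} {T : measurableType d} {R : realType}.
Variable P : probability T R.
Implicit Types f g : T -> R.

(* Restricting to nonnegative functions, linearity needs no integrability. *)
Definition ge0_mean f (m : R) :=
  [/\ measurable_fun [set: T] f, forall w, 0 <= f w &
      (\int[P]_w (f w)%:E = m%:E)%E].

Lemma eq_ge0_mean f g m n : f =1 g -> m = n -> ge0_mean f m -> ge0_mean g n.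
Proof. by move=> /funext-> ->. Qed.

Lemma ge0_mean_cst (k : R) : 0 <= k -> ge0_mean (fun=> k) k.
Proof.
move=> k0; split => //.
by rewrite integral_cst//= probability_setT mule1.
Qed.

Lemma ge0_meanD f g m n :
  ge0_mean f m -> ge0_mean g n -> ge0_mean (fun w => f w + g w) (m + n).
Proof.
move=> [mf f0 fm] [mg g0 gn]; split.
- exact: measurable_funD.
- by move=> w; rewrite addr_ge0.
- under eq_integral do rewrite EFinD.
  by rewrite ge0_integralD//; [rewrite fm gn|move=> *; rewrite lee_fin..
    |exact/measurable_EFinP|move=> *; rewrite lee_fin|exact/measurable_EFinP].
Qed.

Lemma ge0_meanZ (k : R) f m : 0 <= k ->
  ge0_mean f m -> ge0_mean (fun w => k * f w) (k * m).
Proof.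
move=> k0 [mf f0 fm]; split.
- exact: measurable_funM.
- by move=> w; rewrite mulr_ge0.
- under eq_integral do rewrite EFinM.
  rewrite ge0_integralZl ?fm//; first exact/measurable_EFinP.
  by move=> *; rewrite lee_fin.
Qed.

Lemma ge0_mean_sum (I : Type) (r : seq I) (F : I -> T -> R) (m : I -> R) :
  (forall i, ge0_mean (F i) (m i)) ->
  ge0_mean (fun w => \sum_(i <- r) F i w) (\sum_(i <- r) m i).
Proof.
move=> Fm; elim: r => [|i r IHr].
  apply: eq_ge0_mean (ge0_mean_cst (lexx 0)); rewrite ?big_nil//.
  by move=> w; rewrite big_nil.
apply: eq_ge0_mean (ge0_meanD (Fm i) IHr); rewrite ?big_cons//.
by move=> w; rewrite big_cons.
Qed.

(** Stands in for subtraction: negative terms are moved to the other side of an identity, so that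
    all functions stay nonnegative, and the finite mean of [g] cancels in the extended reals. *)
Lemma ge0_mean_addrI f g h m n k : measurable_fun [set: T] f ->
  (forall w, 0 <= f w) -> ge0_mean g n -> ge0_mean h k ->
  (forall w, f w + g w = h w) -> m + n = k -> ge0_mean f m.
Proof.
move=> mf f0 [mg g0 gn] [_ _ hk] fgh mnk; split => //.
move: hk; under eq_integral do rewrite -fgh EFinD.
rewrite ge0_integralD//; [|by move=> *; rewrite lee_fin|exact/measurable_EFinP
  |by move=> *; rewrite lee_fin|exact/measurable_EFinP].
by rewrite gn -mnk EFinD => /(congr1 (fun x => x - n%:E)%E); rewrite !addeK.
Qed.

Lemma ge0_mean_markov f m (e : R) : 0 < e -> ge0_mean f m ->
  (P [set w | (e <= f w)%R] <= (m / e)%:E)%E.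
Proof.
move=> e0 [mf f0 fm]; rewrite EFinM lee_pdivlMr// muleC -fm.
have mEf : measurable_fun [set: T] (fun w => (f w)%:E) by exact/measurable_EFinP.
have := le_integral_abse P measurableT mEf e0.
rewrite setTI; under eq_integral do rewrite gee0_abs ?lee_fin//.
by under eq_set do rewrite /= ger0_norm// lee_fin.
Qed.

End ge0_mean.

(** * Moments of a centered normal variable, possibly a point mass *)

Section centered_normal.
Context {d : measure_display} {T : measurableType d} {R : realType}.
Variables (P : probability T R) (L : T -> R) (v : R).
Hypothesis mL : measurable_fun [set: T] L.
Hypothesis v0 : 0 <= v.
Hypothesis normalL : if 0 < v then forall B : set R, measurable B ->
    P (L @^-1` B) = normal_prob 0 (Num.sqrt v) B
  else P [set w | L w != 0] = 0%E.

(** The exponent [k.*2.+2] is even and positive, so the power is nonnegative and vanishes wherever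
    [L] does, that is almost surely. *)
Lemma degenerate_normal_even_moment k : v = 0 ->
  ge0_mean P (fun w => L w ^+ k.*2.+2) 0.
Proof.
move=> v_0; move: normalL; rewrite v_0 ltxx => PL0.
have mLk : measurable_fun [set: T] (fun w => L w ^+ k.*2.+2).
  exact: measurable_funX.
have Lk0 w : 0 <= L w ^+ k.*2.+2 by rewrite exprn_even_ge0//= negbK odd_double.
split => //.
rewrite -[RHS](@integral0 _ _ _ P setT); apply: ge0_ae_eq_integral => //.
- exact/measurable_EFinP.
- by move=> *; rewrite lee_fin.
- exists [set w | L w != 0]; split => //.
    rewrite -[X in measurable X]setTI.
    rewrite (_ : [set _ | _] = L @^-1` (~` [set 0])); last first.
      by apply/seteqP; split => w /= /eqP.
    by apply: mL => //; exact: measurableC.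
  move=> w /= /not_implyP[_ Lw]; apply: contra_notN Lw => /eqP ->.
  by rewrite expr0n.
Qed.

Lemma centered_normal_even_moment k (m : R) : 0 < v ->
  (\int[lebesgue_measure]_x (x ^+ k.*2 * normal_pdf 0 (Num.sqrt v) x)%:E = m%:E)%E ->
  ge0_mean P (fun w => L w ^+ k.*2) m.
Proof.
move=> v_gt0 km; move: normalL; rewrite v_gt0 => PL.
have ek (x : R) : 0 <= x ^+ k.*2 by rewrite exprn_even_ge0//= odd_double.
have mX : measurable_fun [set: R] (fun x : R => (x ^+ k.*2)%:E).
  exact/measurable_EFinP/measurable_funX.
split => //; first exact: measurable_funX.
rewrite -km.
(* Retyping the codomain of [L] lets its pushforward and the normal law be compared as measures on
   one space. *)
have mL' : measurable_fun [set: T] (L : T -> measurableTypeR R) by [].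
pose L' : {mfun T >-> measurableTypeR R} :=
  HB.pack (L : T -> measurableTypeR R) (isMeasurableFun.Build _ _ _ _ _ mL').
transitivity (\int[pushforward P L']_x (x ^+ k.*2)%:E)%E.
  by rewrite ge0_integral_pushforward// => x _; rewrite lee_fin.
under [RHS]eq_integral do rewrite EFinM.
rewrite -ge0_integral_normal_prob//.
apply: (@eq_measure_integral _ _ _ _ (normal_prob 0 (Num.sqrt v))
  (pushforward P L')) => B mB _; exact: PL.
Qed.

Lemma centered_normal_moment2 : ge0_mean P (fun w => L w ^+ 2) v.
Proof.
move: v0; rewrite le_eqVlt => /orP[/eqP v_0|v_gt0].
  by rewrite -[X in ge0_mean _ _ X]v_0; apply: (@degenerate_normal_even_moment 0).
apply: (@centered_normal_even_moment 1) => //.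
by rewrite normal_pdf_moment2 ?sqrtr_gt0// sqr_sqrtr.
Qed.

Lemma centered_normal_moment4 : ge0_mean P (fun w => L w ^+ 4) (3 * v ^+ 2).
Proof.
move: v0; rewrite le_eqVlt => /orP[/eqP v_0|v_gt0].
  rewrite [X in ge0_mean _ _ X](_ : _ = 0); last by rewrite -v_0 expr0n mulr0.
  exact: (@degenerate_normal_even_moment 1).
apply: (@centered_normal_even_moment 2) => //.
rewrite normal_pdf_moment4 ?sqrtr_gt0//.
by rewrite (exprM _ 2 2) sqr_sqrtr.
Qed.

End centered_normal.

(** * Zero-sum linear combinations of an equicorrelated Gaussian vector *)

Section equicorrelated.
Context {d : measure_display} {T : measurableType d} {R : realType}.
Variables (P : probability T R) (n : nat) (X : 'I_n -> {RV P >-> R}) (rho : R).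
Hypothesis rho1 : rho <= 1.
Hypothesis gX : centered_gaussian_vector X (equicorr n rho).
Implicit Types t u v : 'I_n -> R.

Local Notation L := (lincomb (fun i => (X i : T -> R))).
Local Notation dot u v := (\sum_(i < n) u i * v i).

(** The covariance matrix is [(1 - rho) I + rho J], with [J] the matrix of ones, and [J] kills
    zero-sum vectors. *)
Lemma quadform_equicorr_sum0 t : \sum_i t i = 0 ->
  quadform (equicorr n rho) t = (1 - rho) * dot t t.
Proof.
move=> t0; rewrite /quadform mulr_sumr; apply: eq_bigr => i _.
transitivity (\sum_j (t i * rho * t j + (if j == i then (1 - rho) * (t i * t i) else 0))).
  apply: eq_bigr => j _; rewrite mxE eq_sym; case: eqP => [->|_]; ring.
by rewrite big_split/= -mulr_sumr t0 mulr0 add0r -big_mkcond big_pred1_eq.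
Qed.

Lemma measurable_lincomb t : measurable_fun [set: T] (L t).
Proof. by apply: measurable_sum => i; apply: measurable_funM. Qed.

Let normalL t : \sum_i t i = 0 -> 0 <= (1 - rho) * dot t t /\
  if 0 < (1 - rho) * dot t t then forall B : set R, measurable B ->
    P (L t @^-1` B) = normal_prob 0 (Num.sqrt ((1 - rho) * dot t t)) B
  else P [set w | L t w != 0] = 0%E.
Proof.
move=> t0; split; last by rewrite -quadform_equicorr_sum0//; exact: gX.
rewrite mulr_ge0 ?subr_ge0// sumr_ge0// => i _.
by rewrite -expr2 sqr_ge0.
Qed.

Lemma lincomb_moment2 t : \sum_i t i = 0 ->
  ge0_mean P (fun w => L t w ^+ 2) ((1 - rho) * dot t t).
Proof.
by move=> /normalL[? ?]; apply: centered_normal_moment2 => //;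
  exact: measurable_lincomb.
Qed.

Lemma lincomb_moment4 t : \sum_i t i = 0 ->
  ge0_mean P (fun w => L t w ^+ 4) (3 * ((1 - rho) * dot t t) ^+ 2).
Proof.
by move=> /normalL[? ?]; apply: centered_normal_moment4 => //;
  exact: measurable_lincomb.
Qed.

(* Polarization: [12 a^2 b^2 + 2 a^4 + 2 b^4 = (a + b)^4 + (a - b)^4]. *)
Lemma lincomb_moment22 u v : \sum_i u i = 0 -> \sum_i v i = 0 ->
  ge0_mean P (fun w => L u w ^+ 2 * L v w ^+ 2)
    ((1 - rho) ^+ 2 * (dot u u * dot v v + 2 * dot u v ^+ 2)).
Proof.
move=> u0 v0.
have LD w : L (fun i => u i + v i) w = L u w + L v w.
  by rewrite /lincomb -big_split/=; apply: eq_bigr => i _; rewrite mulrDl.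
have LB w : L (fun i => u i - v i) w = L u w - L v w.
  by rewrite /lincomb -sumrB; apply: eq_bigr => i _; rewrite mulrBl.
have dD : dot (fun i => u i + v i) (fun i => u i + v i) =
    dot u u + dot v v + 2 * dot u v.
  by rewrite mulr_sumr -!big_split/=; apply: eq_bigr => i _; ring.
have dB : dot (fun i => u i - v i) (fun i => u i - v i) =
    dot u u + dot v v - 2 * dot u v.
  by rewrite mulr_sumr -big_split -sumrB/=; apply: eq_bigr => i _; ring.
have MD : \sum_i (u i + v i) = 0 by rewrite big_split/= u0 v0 addr0.
have MB : \sum_i (u i - v i) = 0 by rewrite sumrB u0 v0 subr0.
have {}MD := lincomb_moment4 MD; have {}MB := lincomb_moment4 MB.
have Mu := ge0_meanZ (ler0n _ 2) (lincomb_moment4 u0).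
have Mv := ge0_meanZ (ler0n _ 2) (lincomb_moment4 v0).
have mL22 : measurable_fun [set: T] (fun w => 12 * (L u w ^+ 2 * L v w ^+ 2)).
  by do 2 apply: measurable_funM => //;
    apply: measurable_funX; exact: measurable_lincomb.
have L22_ge0 w : 0 <= 12 * (L u w ^+ 2 * L v w ^+ 2).
  by apply: mulr_ge0 => //; apply: mulr_ge0; exact: sqr_ge0.
suff : ge0_mean P (fun w => 12 * (L u w ^+ 2 * L v w ^+ 2))
    (12 * ((1 - rho) ^+ 2 * (dot u u * dot v v + 2 * dot u v ^+ 2))).
  have i12 : 0 <= 12^-1 :> R by rewrite invr_ge0.
  by move=> /(ge0_meanZ i12); apply: eq_ge0_mean => [w|]; field.
apply: (ge0_mean_addrI mL22 L22_ge0 (ge0_meanD Mu Mv) (ge0_meanD MD MB)).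
- by move=> w; rewrite LD LB; ring.
- by rewrite dD dB; ring.
Qed.

End equicorrelated.

(** * The centering matrix and the sample variance as a sum of squares *)

Section sample_variance.
Context {R : realType}.
Variable n : nat.
Hypothesis n_gt0 : (0 < n)%N.

(** Row [i] of the orthogonal projection [I - J / n] onto zero-sum vectors. *)
Definition centering (i j : 'I_n) : R := (j == i)%:R - n%:R^-1.

Let n_neq0 : n%:R != 0 :> R. Proof. by rewrite pnatr_eq0 -lt0n. Qed.

Let sum_delta (i : 'I_n) (f : 'I_n -> R) : \sum_j (j == i)%:R * f j = f i.
Proof.
rewrite (bigD1 i)//= eqxx mul1r big1 ?addr0// => j /negbTE ->.
by rewrite mul0r.
Qed.

Lemma sum_centering i : \sum_j centering i j = 0.
Proof.
rewrite sumrB sumr_const card_ord -[X in _ - X]mulr_natr mulVf//.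
have := sum_delta i (fun=> 1); under eq_bigr do rewrite mulr1.
by move=> ->; rewrite subrr.
Qed.

(** The centering matrix is symmetric and idempotent, so the Gram matrix of its rows is itself. *)
Lemma dot_centering i j :
  \sum_k centering i k * centering j k = (i == j)%:R - n%:R^-1.
Proof.
transitivity (\sum_k ((k == i)%:R * centering j k - n%:R^-1 * centering j k)).
  by apply: eq_bigr => k _; rewrite -mulrBl.
by rewrite sumrB -mulr_sumr sum_centering mulr0 subr0 sum_delta.
Qed.

Lemma sum_dot_centering :
  \sum_i \sum_k centering i k * centering i k = n.-1%:R.
Proof.
under eq_bigr do rewrite dot_centering eqxx.
rewrite sumr_const card_ord -[LHS]mulr_natr mulrBl mulVf// mul1r.
by rewrite -[in LHS](prednK n_gt0) -natr1 addrK.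
Qed.

(** For a symmetric idempotent matrix, the squared Frobenius norm equals the trace. *)
Lemma sum_sqr_dot_centering :
  \sum_i \sum_j (\sum_k centering i k * centering j k) ^+ 2 = n.-1%:R.
Proof.
rewrite -sum_dot_centering; apply: eq_bigr => i _; apply: eq_bigr => j _.
by rewrite dot_centering -expr2 eq_sym.
Qed.

Lemma sample_varE (x : 'I_n -> R) :
  sample_var (\col_i x i) = n.-1%:R^-1 * \sum_i (\sum_j centering i j * x j) ^+ 2.
Proof.
rewrite /sample_var; congr (_ * _).
have cx i : \sum_j centering i j * x j = x i - n%:R^-1 * \sum_j x j.
  under eq_bigr do rewrite mulrBl.
  by rewrite sumrB sum_delta -mulr_sumr.
rewrite -mulmxA !mxE.
transitivity (\sum_i x i * \sum_j centering i j * x j).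
  apply: eq_bigr => i _; rewrite !mxE; congr (_ * _).
  by apply: eq_bigr => j _; rewrite !mxE mulr1 eq_sym.
under eq_bigr do rewrite cx.
under [RHS]eq_bigr do rewrite cx.
set m := \sum_j x j.
(* One factor of each square is split; the subtracted part is a multiple of the sum of the
   deviations from the mean, which is 0. *)
have -> : \sum_i (x i - n%:R^-1 * m) ^+ 2 =
    \sum_i x i * (x i - n%:R^-1 * m) - n%:R^-1 * m * \sum_i (x i - n%:R^-1 * m).
  by rewrite [X in _ - X]mulr_sumr -sumrB; apply: eq_bigr => i _; ring.
rewrite [X in _ - _ * X]sumrB sumr_const card_ord -/m -[_ *+ n]mulr_natr.
by rewrite [X in _ - _ * (_ - X)](_ : _ = m) ?subrr ?mulr0 ?subr0//; field.
Qed.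

End sample_variance.

(** * Mean square error of the sample variance *)

Section sample_variance_equicorrelated.
Context {d : measure_display} {T : measurableType d} {R : realType}.
Variables (P : probability T R) (n : nat) (X : 'I_n -> {RV P >-> R}) (rho : R).
Hypothesis n_gt1 : (1 < n)%N.
Hypothesis rho1 : rho <= 1.
Hypothesis gX : centered_gaussian_vector X (equicorr n rho).

Let n_gt0 : (0 < n)%N. Proof. exact: ltnW. Qed.

Local Notation s2 w := (sample_var (\col_i (X i : T -> R) w)).

Let W w : R := \sum_i lincomb (fun i => (X i : T -> R)) (centering i) w ^+ 2.

Let s2E w : s2 w = n.-1%:R^-1 * W w.
Proof. exact: sample_varE. Qed.

Let meanW : ge0_mean P W ((1 - rho) * n.-1%:R).
Proof.
rewrite -(sum_dot_centering n_gt0) mulr_sumr; apply: ge0_mean_sum => i.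
exact/lincomb_moment2/sum_centering.
Qed.

(** The square expands into a double sum of mixed fourth moments. Products of squared norms
    contribute the squared trace [(n-1)^2], and the squared inner products twice the trace. *)
Let meanW2 : ge0_mean P (fun w => W w ^+ 2)
  ((1 - rho) ^+ 2 * (n.-1%:R ^+ 2 + 2 * n.-1%:R)).
Proof.
have c0 i := @sum_centering R n n_gt0 i.
have := @ge0_mean_sum _ _ _ P _ (index_enum 'I_n) _ _ (fun i =>
  @ge0_mean_sum _ _ _ P _ (index_enum 'I_n) _ _ (fun j =>
    lincomb_moment22 rho1 gX (c0 i) (c0 j))).
apply: eq_ge0_mean => [w|].
  by rewrite expr2 [RHS]mulr_suml; apply: eq_bigr => i _; rewrite mulr_sumr.
under eq_bigr do rewrite -mulr_sumr big_split/= -!mulr_sumr.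
rewrite -mulr_sumr big_split/= -mulr_sumr -mulr_suml.
by rewrite sum_sqr_dot_centering// sum_dot_centering.
Qed.

Let measurable_W : measurable_fun [set: T] W. Proof. by case: meanW. Qed.

Lemma measurable_sample_var : measurable_fun [set: T] (fun w => s2 w).
Proof. by under eq_fun do rewrite s2E; exact: measurable_funM. Qed.

Lemma sample_var_ge0 w : 0 <= s2 w.
Proof. by rewrite s2E mulr_ge0 ?invr_ge0//; case: meanW. Qed.

Lemma sample_var_mse : ge0_mean P (fun w => (s2 w - (1 - rho)) ^+ 2)
  (2 * (1 - rho) ^+ 2 / n.-1%:R).
Proof.
have n1 : n.-1%:R != 0 :> R by rewrite pnatr_eq0 -lt0n -ltnS prednK.
pose mu := (1 - rho) * n.-1%:R.
have mu0 : 0 <= mu by rewrite mulr_ge0 ?subr_ge0.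
have mZ : measurable_fun [set: T] (fun w => (W w - mu) ^+ 2).
  by apply: measurable_funX; exact: measurable_funB.
have Z0 w : 0 <= (W w - mu) ^+ 2 by exact: sqr_ge0.
have mu20 : 0 <= 2 * mu by rewrite mulr_ge0.
have i0 : 0 <= n.-1%:R ^- 2 :> R by rewrite invr_ge0 sqr_ge0.
suff /(ge0_meanZ i0) : ge0_mean P (fun w => (W w - mu) ^+ 2)
    (2 * (1 - rho) ^+ 2 * n.-1%:R).
  apply: eq_ge0_mean => [w|]; last by field.
  by rewrite s2E /mu; field.
(* The identity used is [(W - mu)^2 + 2 mu W = W^2 + mu^2], in which every term is nonnegative. *)
apply: (ge0_mean_addrI mZ Z0 (ge0_meanZ mu20 meanW)
  (ge0_meanD meanW2 (ge0_mean_cst P (sqr_ge0 mu)))).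
- by move=> w; ring.
- by rewrite /mu; ring.
Qed.

Lemma sample_var_chebyshev (e : R) : 0 < e ->
  (P [set w | (e <= `|s2 w - (1 - rho)|)%R] <=
   (2 * (1 - rho) ^+ 2 / n.-1%:R / e ^+ 2)%:E)%E.
Proof.
move=> e0; have := ge0_mean_markov (exprn_gt0 2 e0) sample_var_mse.
under eq_set do rewrite -ler_sqrt ?sqr_ge0// !sqrtr_sqr (gtr0_norm e0).
by [].
Qed.

End sample_variance_equicorrelated.

(** * Deterministic control of the estimator by the sample variance *)

Lemma rho_hat_minr (R : realType) (x : R) : 1 - rho_hat x = Num.min x 1.
Proof. by rewrite /rho_hat minEle; case: (ltgtP x 1) => [_|_|->]; ring. Qed.

(** Since [c <= 1], truncating [x] at 1 does not move it away from [c]; then [c - y] factors as a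
    difference of squares whose second factor is at least [Num.sqrt c]. *)
Lemma sqrt_rho_hat_le (R : realType) (c x : R) : 0 <= c <= 1 -> 0 <= x ->
  `|Num.sqrt c - Num.sqrt (1 - rho_hat x)| * Num.sqrt c <= `|x - c|.
Proof.
move=> /andP[c0 c1] x0; rewrite rho_hat_minr; set y := Num.min x 1.
have y0 : 0 <= y by rewrite le_min x0 ler01.
apply: (@le_trans _ _ `|c - y|); last first.
  by rewrite /y minEle; case: (leP x 1) => x1; rewrite ?(distrC c)// !ger0_norm; lra.
have -> : c - y = (Num.sqrt c - Num.sqrt y) * (Num.sqrt c + Num.sqrt y).
  by rewrite -subr_sqr !sqr_sqrtr.
rewrite normrM ler_wpM2l//.
by rewrite ger0_norm ?addr_ge0 ?sqrtr_ge0// lerDl sqrtr_ge0.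
Qed.

(** * Convergence in probability by squeezing *)

Unset Implicit Arguments.
Set Strict Implicit.

Theorem theorem1 (R : realType) (rho : R) (d : measure_display)
  (T : nat -> measurableType d) (P : forall n, probability (T n) R)
  (X : forall n, 'I_n -> {RV (P n) >-> R}) (a : nat -> R) :
  0 < rho < 1 ->
  (forall n, (2 <= n)%N -> centered_gaussian_vector (X n) (equicorr n rho)) ->
  (forall n, 0 < a n) ->
  (fun n => a n / n%:R) @ \oo --> 0 ->
  forall eps : R, 0 < eps ->
    (fun n => P n [set w | eps <=
       `| Num.sqrt (a n) *
          (Num.sqrt (1 - rho)
           - Num.sqrt (1 - rho_hat (sample_var (\col_i (X n i : T n -> R) w))))|])
    @ \oo --> 0%E.
Proof.
move=> /andP[rho0 rho1] gX a0 cvga eps eps0.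
pose c := 1 - rho.
have c0 : 0 < c by rewrite subr_gt0.
have c1 : c <= 1 by rewrite /c; lra.
have K0 : 0 <= 4 * c / eps ^+ 2 by rewrite divr_ge0 ?sqr_ge0// mulr_ge0// ltW.
apply: (@squeeze_cvge _ _ _ _ (fun=> 0%E) _
  (fun n => (4 * c / eps ^+ 2 * (a n / n%:R))%:E)); last 2 first.
- exact: cvg_cst.
- apply: cvg_EFin; first by near=> n.
  rewrite -[X in _ --> X](mulr0 (4 * c / eps ^+ 2)).
  by apply: cvgM => //; exact: cvg_cst.
near=> n.
have n1 : (1 < n)%N by near: n; exact: nbhs_infty_gt.
have {}gX := gX n n1.
rewrite measure_ge0/=.
have sa0 : 0 < Num.sqrt (a n) by rewrite sqrtr_gt0.
have sc0 : 0 < Num.sqrt c by rewrite sqrtr_gt0.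
(* The deviation of the sample variance forced by an [eps]-deviation of the scaled difference of
   square roots, through [sqrt_rho_hat_le]. *)
pose e := eps * Num.sqrt c / Num.sqrt (a n).
have e0 : 0 < e by rewrite divr_gt0// mulr_gt0.
have ms2 := measurable_sample_var n1 (ltW rho1) gX.
have e2 : e ^+ 2 = eps ^+ 2 * c / a n.
  by rewrite /e !exprMn exprVn !sqr_sqrtr ?ltW.
have np : 0 < n.-1%:R :> R by rewrite ltr0n -ltnS prednK// ltnW.
apply: (@le_trans _ _ (2 * c ^+ 2 / n.-1%:R / e ^+ 2)%:E); last first.
  rewrite lee_fin e2.
  (* The factor 2 is doubled to 4 so that [n <= 2 (n - 1)], valid from [n = 2] on, replaces [n - 1]
     by [n]. *)
  have -> : 2 * c ^+ 2 / n.-1%:R / (eps ^+ 2 * c / a n) =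
      4 * c / eps ^+ 2 * (a n / (2 * n.-1%:R)).
    by field; rewrite !gt_eqF//= a0.
  rewrite ler_wpM2l// ler_pM2l//.
  rewrite lef_pV2 ?posrE ?mulr_gt0// ?ltr0n ?(ltnW n1)//.
  rewrite -natrM ler_nat.
  by move: n1; clear; case: n => [|[|n]]// _; rewrite mul2n -addnn addSn ltnS leq_addl.
apply: le_trans (sample_var_chebyshev n1 (ltW rho1) gX e0).
(* Monotonicity of the measure asks for both events to be measurable; writing the truncation as a
   minimum settles this for the first. *)
apply: le_measure; rewrite ?inE.
- rewrite -[X in measurable X]setTI.
  apply: measurable_fun_le => //.
  apply: measurableT_comp => //=; apply: measurable_funM => //.
  under eq_fun do rewrite rho_hat_minr.
  apply: measurable_funB => //; apply: measurableT_comp.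
    exact: continuous_measurable_fun (@sqrt_continuous R).
  exact: measurable_minr.
- rewrite -[X in measurable X]setTI.
  apply: measurable_fun_le => //.
  by apply: measurableT_comp => //; exact: measurable_funB.
- move=> w /=; rewrite normrM (gtr0_norm sa0) => le_eps.
  rewrite /e ler_pdivrMr// [leRHS]mulrC.
  have s20 := sample_var_ge0 n1 (ltW rho1) gX w.
  have := @sqrt_rho_hat_le R c _ _ s20; rewrite c1 ltW// => /(_ isT) le_s2.
  apply: (@le_trans _ _ (Num.sqrt (a n) * (_ * Num.sqrt c))).
    by rewrite mulrA; apply: ler_wpM2r le_eps; exact: ltW.
  by apply: ler_wpM2l le_s2; exact: ltW.
Unshelve. all: end_near. Qed.
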